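(* Let $p$ be a prime, $q=p^\lambda$ with $\lambda\ge1$, and let $F$ be a field with $\mathbb F_q\subseteq F$. Let $E=\{e_j(x)\}_{j=0}^\infty$ be a sequence of $\mathbb F_q$-linear polynomials in $F[x]$. For each integer $i\ge0$ with $q$-adic expansion $i=\sum_{t} i_tq^t$ ($0\le i_t<q$), put $$p_{E,i}(x):=\prod_t e_t(x)^{i_t}.$$ Then the sequence $P_E:=\{p_{E,i}(x)\}_{i=0}^\infty$ is a nontrivial sequence satisfying the Binomial Theorem (equivalently, its generating function lies in $\mathfrak{BD}^\ast$).
   Context: A polynomial in $F[x]$ is $\mathbb F_q$-linear if it is a finite $F$-linear combination of monomials $x^{q^n}$, $n\ge0$ (the zero polynomial is allowed). The convention $e^0=1$ is used, also for $e=0$. A sequence $P=\{p_i(x)\}_{i=0}^\infty$ of polynomials in $F[x]$ satisfies the Binomial Theorem if $p_n(x+y)=\sum_{i=0}^n \binom{n}{i}p_i(x)p_{n-i}(y)$ in $F[x,y]$ for all $n\ge 0$; it is nontrivial if not all $p_i(x)$ are zero. $F[x]\{\{\mathfrak D\}\}$ is the commutative ring of formal series $\sum_{i\ge0}a_i\mathfrak D_i$ ($a_i\in F[x]$) with $\mathfrak D_i\mathfrak D_j=\binom{i+j}{i}\mathfrak D_{i+j}$. The generating function of a sequence $P$ is $\sum_{i\ge0}p_i(x)\mathfrak D_i$, and $\mathfrak{BD}^\ast$ is the set of generating functions of all nontrivial sequences satisfying the Binomial Theorem. *)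

(* Defs.v *)
From HB Require Import structures.
From mathcomp Require Import all_boot all_algebra.
From mathcomp Require Import boolp functions.
From mathcomp Require Import ring.

Set Implicit Arguments.
Unset Strict Implicit.
Unset Printing Implicit Defensive.

Import GRing.Theory.
Local Open Scope ring_scope.

Definition Fq_linear (F : fieldType) (q : nat) (f : {poly F}) : Prop :=
  exists (N : nat) (a : nat -> F), f = \sum_(n < N) a n *: 'X^(q ^ n)%N.

(* In {poly {poly F}}, p(x), p(y) and p(x + y) are p^:P, p%:P and poly_XaY p,
   the outer variable being x and the inner one y. *)
Definition binomial_theorem (F : fieldType) (P : nat -> {poly F}) : Prop :=
  forall n : nat,
    poly_XaY (P n) = \sum_(i < n.+1) (P i)^:P * (P (n - i)%N)%:P *+ 'C(n, i).

Definition nontrivial (F : fieldType) (P : nat -> {poly F}) : Prop :=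
  exists i : nat, P i != 0.

Definition qdigit (q i t : nat) : nat := ((i %/ q ^ t) %% q)%N.

Lemma qdigit_small (q i t : nat) : (1 < q)%N -> (i <= t)%N -> qdigit q i t = 0%N.
Proof.
move=> q1 it; rewrite /qdigit divn_small ?mod0n //.
exact: leq_ltn_trans it (ltn_expl t q1).
Qed.

Lemma qdigit_expansion (q i N : nat) : (1 < q)%N -> (i <= N)%N ->
  i = (\sum_(t < N) qdigit q i t * q ^ t)%N.
Proof.
move=> q1 iN.
have H M : (i = i %/ q ^ M * q ^ M + \sum_(t < M) qdigit q i t * q ^ t)%N.
  elim: M => [|M IH]; first by rewrite big_ord0 expn0 divn1 muln1 addn0.
  rewrite big_ord_recr /= [LHS]IH [in LHS](divn_eq (i %/ q ^ M) q).
  by rewrite mulnDl -divnMA -mulnA -expnS -expnSr -addnA [in RHS](addnC (\sum_(_ < _) _)%N).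
rewrite {1}(H N) divn_small //.
exact: leq_ltn_trans iN (ltn_expl N q1).
Qed.

(* For 1 < q, all digits of i at positions t >= i vanish (qdigit_small), so
   the product over t < i contains every factor different from e_t(x)^0 = 1. *)
Definition qadic_product (F : fieldType) (q : nat) (e : nat -> {poly F})
    (i : nat) : {poly F} :=
  \prod_(t < i) e t ^+ qdigit q i t.

(* The formal series \sum_i (f i) D_i is the function f. *)
Definition dseries (R : comNzRingType) : Type := nat -> R.

HB.instance Definition _ (R : comNzRingType) :=
  GRing.Zmodule.copy (dseries R) (nat -> R).

Section DSeriesRing.
Variable R : comNzRingType.
Implicit Types f g h : dseries R.

Definition dseries_basis (i : nat) : dseries R := fun n => (n == i)%:R.

Definition dseries_mul f g : dseries R :=
  fun n => \sum_(i < n.+1) f i * g (n - i)%N *+ 'C(n, i).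

Fact dseries_mulC : commutative dseries_mul.
Proof.
move=> f g; apply/funext => n; rewrite /dseries_mul (reindex_inj rev_ord_inj) /=.
apply: eq_bigr => i _; have le_in : (i <= n)%N by rewrite -ltnS.
by rewrite subSS subKn// mulrC bin_sub.
Qed.

Fact dseries_mulA : associative dseries_mul.
Proof.
move=> f g h; rewrite (dseries_mulC g) (dseries_mulC _ h).
apply/funext => n; rewrite /dseries_mul.
pose c j k := f j * h k * g (n - j - k)%N *+ ('C(n - j, k) * 'C(n, j)).
transitivity (\sum_(j < n.+1) \sum_(k < n.+1 | (k <= n - j)%N) c j k).
  apply: eq_bigr => /= j _; rewrite (big_ord_narrow_leq (leq_subr _ _)) /=.
  rewrite big_distrr -sumrMnl; apply: eq_bigr => k _ /=.
  by rewrite /c mulrnA mulrnAr mulrA.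
rewrite (exchange_big_dep predT) //=; apply: eq_bigr => k _.
transitivity (\sum_(j < n.+1 | (j <= n - k)%N) c j k).
  apply: eq_bigl => j; have := leq_ord j; have := leq_ord k => kn jn.
  by rewrite !leq_subRL// addnC.
rewrite (big_ord_narrow_leq (leq_subr _ _)) big_distrr -sumrMnl.
apply: eq_bigr => j _ /=; have jk : (j <= n - k)%N by rewrite -ltnS.
have kn : (k <= n)%N by rewrite -ltnS.
have jn := leq_trans jk (leq_subr _ _).
have kj : (k <= n - j)%N by rewrite leq_subRL// addnC -leq_subRL.
rewrite /c mulrnAr -mulrnA mulrA (mulrC (f j)) -!subnDA (addnC j k).
congr (_ *+ _); apply/eqP.
have pos : (0 < j`! * (k`! * (n - j - k)`!))%N by rewrite !muln_gt0 !fact_gt0.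
rewrite -(eqn_pmul2r pos); apply/eqP.
transitivity n`!.
  rewrite -(bin_fact jn) -(bin_fact kj).
  move: j`! k`! (n - j - k)`! 'C(_, _) 'C(_, _) => *; ring.
rewrite -(bin_fact kn) -(bin_fact jk) -!subnDA (addnC j k).
move: j`! k`! (n - _)`! 'C(_, _) 'C(_, _) => *; ring.
Qed.

Fact dseries_mul1 : left_id (dseries_basis 0%N) dseries_mul.
Proof.
move=> f; apply/funext => n; rewrite /dseries_mul big_ord_recl big1 => [|i _].
  by rewrite addr0 /dseries_basis mul1r subn0 bin0.
by rewrite /dseries_basis mul0r mul0rn.
Qed.

Fact dseries_mulDl : left_distributive dseries_mul +%R.
Proof.
move=> f g h; apply/funext => n; rewrite /dseries_mul.
rewrite [RHS]/GRing.add /= -big_split; apply: eq_bigr => i _ /=.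
by rewrite -mulrnDl -mulrDl.
Qed.

Fact dseries_oner_neq0 : dseries_basis 0%N != 0.
Proof.
by apply/eqP => /(congr1 (fun f => f 0%N)) /eqP; rewrite /dseries_basis oner_eq0.
Qed.

HB.instance Definition _ := GRing.Zmodule_isComNzRing.Build (dseries R)
  dseries_mulA dseries_mulC dseries_mul1 dseries_mulDl dseries_oner_neq0.

Lemma dseries_basisM (i j : nat) :
  dseries_basis i * dseries_basis j = dseries_basis (i + j)%N *+ 'C(i + j, i).
Proof.
apply/funext => n.
have -> : (dseries_basis (i + j)%N *+ 'C(i + j, i)) n
          = (n == i + j)%N%:R *+ 'C(i + j, i).
  by elim: 'C(i + j, i) => [//|m IH]; rewrite !mulrS -IH.
rewrite {1}/GRing.mul /= /dseries_mul /dseries_basis.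
case: eqVneq => [->|nij].
  rewrite (bigD1 (inord i)) //= inordK ?ltnS ?leq_addr// eqxx mul1r addKn eqxx.
  rewrite big1 ?addr0// => k ki; rewrite (_ : (k == i :> nat) = false) ?mul0r ?mul0rn//.
  apply: contra_neqF ki => /eqP ki; apply: val_inj.
  by rewrite /= inordK ?ltnS ?leq_addr.
rewrite mul0rn big1 // => k _.
case: (k =P i :> nat) => [ki|]; last by rewrite mul0r mul0rn.
case: (n - k =P j)%N => [kj|]; last by rewrite mulr0 mul0rn.
by case/eqP: nij; rewrite -ki -kj subnKC // -ltnS.
Qed.

End DSeriesRing.

Definition generating_function (F : fieldType) (P : nat -> {poly F}) :
  dseries {poly F} := fun i => P i.

Definition BDstar (F : fieldType) (f : dseries {poly F}) : Prop :=
  exists P : nat -> {poly F},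
    [/\ nontrivial P, binomial_theorem P & f = generating_function P].

(* Main.v *)
(* Both Lucas' congruence and the exponents i_t are multiplicative in the base-q
   digits.  Since each e_t is additive, the ordinary binomial formula for
   (e_t(x) + e_t(y))^(i_t) can be applied to one digit at a time, and Lucas
   recombines the binomial coefficients; the terms with a carry vanish. *)

Require Import Defs.
From mathcomp Require Import all_boot all_algebra all_field ring.

Import GRing.Theory.
Local Open Scope ring_scope.

Lemma coefXD1n (R : nzRingType) (n i : nat) :
  (('X + 1) ^+ n : {poly R})`_i = 'C(n, i)%:R.
Proof.
rewrite addrC exprDn_comm; last exact/esym/commr1.
under eq_bigr => j _ do rewrite expr1n mul1r.
rewrite coef_sum.
under eq_bigr => j _ do rewrite coefMn coefXn.
have [lt_in|le_ni] := ltnP i n.+1.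
  rewrite (bigD1 (Ordinal lt_in)) //= eqxx big1 ?addr0 // => j.
  rewrite -val_eqE /= eq_sym => /negPf->.
  by rewrite mul0rn.
rewrite bin_small // big1 // => j _.
by rewrite (gtn_eqF (leq_trans (ltn_ord j) le_ni)) mul0rn.
Qed.

(* Lucas' congruence for one base-q digit, q a power of the characteristic:
   by comparing coefficients in (1 + X)^(mq + r) = (1 + X^q)^m (1 + X)^r. *)
Lemma natr_bin_digit (R : comNzRingType) (q m r k s : nat) :
  [pchar R].-nat q -> (r < q)%N -> (s < q)%N ->
  'C(m * q + r, k * q + s)%:R = ('C(m, k) * 'C(r, s))%:R :> R.
Proof.
move=> q_char lt_rq lt_sq.
have q_charP : [pchar {poly R}].-nat q.
  by rewrite (eq_pnat _ (@pchar_poly R)).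
rewrite -coefXD1n exprD mulnC exprM exprDn_pchar // expr1n.
rewrite addrC exprDn mulr_suml coef_sum.
(* The [j]-th term is a multiple of X^(jq) (1 + X)^r, which lives in degrees jq to jq + r. As r and
   s are below q, the degree kq + s falls in this range only if j = k. *)
have coef_term (j : nat) :
  (1 ^+ (m - j) * 'X^q ^+ j *+ 'C(m, j) * ('X + 1) ^+ r : {poly R})`_(k * q + s)
  = if (j == k)%N then ('C(m, k) * 'C(r, s))%:R else 0.
  rewrite expr1n mul1r -exprM mulrnAl coefMn coefXnM.
  rewrite coefXD1n (mulnC q).
  case: (ltngtP j k) => [lt_jk|lt_kj|->].
  - rewrite ltnNge (leq_trans (leq_mul (ltnW lt_jk) (leqnn q)) (leq_addr _ _)) /=.
    rewrite bin_small ?mul0rn // (leq_trans lt_rq) // leq_subRL.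
      by rewrite addnC -mulSn (leq_trans (leq_mul lt_jk (leqnn q))) ?leq_addr.
    by rewrite (leq_trans (leq_mul (ltnW lt_jk) (leqnn q))) ?leq_addr.
  - rewrite (_ : (_ < _)%N) ?mul0rn //.
    by rewrite (leq_trans _ (leq_mul lt_kj (leqnn q))) // mulSn addnC ltn_add2r.
  - by rewrite ltnNge leq_addr /= addKn mulnC natrM mulr_natr.
under eq_bigr => j _ do rewrite coef_term.
have [lt_km|le_mk] := ltnP k m.+1.
  rewrite (bigD1 (Ordinal lt_km)) //= eqxx big1 ?addr0 // => j.
  by rewrite -val_eqE /= => /negPf->.
rewrite bin_small // mul0n big1 // => j _.
by rewrite (ltn_eqF (leq_trans (ltn_ord j) le_mk)).
Qed.

(** Binomials vanish above the diagonal, so the values of [F] beyond [n], where [n - i] truncates to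
    0, are harmless. This allows ranges that split evenly into digits. *)
Lemma sum_bin_widen (V : nmodType) (n N : nat) (F : nat -> V) : (n < N)%N ->
  \sum_(i < n.+1) F i *+ 'C(n, i) = \sum_(i < N) F i *+ 'C(n, i).
Proof.
move=> lt_nN; rewrite (big_ord_widen _ (fun i => F i *+ 'C(n, i)) lt_nN).
rewrite big_mkcond; apply: eq_bigr => i _ /=.
by case: ltnP => // lt_ni; rewrite bin_small.
Qed.

Section DigitProduct.
Variables (R : comNzRingType) (q : nat).
Hypothesis q_gt1 : (1 < q)%N.

(** The length [N] does not depend on [i], so all factors in one binomial sum share the same
    positions. *)
Definition digit_product (N : nat) (u : nat -> R) (i : nat) : R :=
  \prod_(t < N) u t ^+ qdigit q i t.

Lemma digit_product_cons (N : nat) (u : nat -> R) (m r : nat) : (r < q)%N ->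
  digit_product N.+1 u (m * q + r)
  = u 0%N ^+ r * digit_product N (u \o succn) m.
Proof.
move=> lt_rq; rewrite /digit_product big_ord_recl /=; congr (_ ^+ _ * _).
  by rewrite /qdigit expn0 divn1 modnMDl modn_small.
apply: eq_bigr => t _; rewrite /qdigit /= expnS divnMA divnMDl ?(ltnW q_gt1) //.
by rewrite (divn_small lt_rq) addn0.
Qed.

Lemma digit_product_widen (N : nat) (u : nat -> R) (i : nat) : (i <= N)%N ->
  digit_product N u i = digit_product i u i.
Proof.
move=> /subnKC <-; rewrite /digit_product big_split_ord /=.
rewrite [X in _ * X]big1 ?mulr1 // => t _.
by rewrite qdigit_small ?leq_addr.
Qed.

(** Induction on the number of digits, with [u] and [v] general because peeling off the lowest digit
    shifts both. *)
Lemma digit_productD (N : nat) (u v : nat -> R) (n : nat) :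
  [pchar R].-nat q -> (n < q ^ N)%N ->
  digit_product N (fun t => u t + v t) n
  = \sum_(i < n.+1)
      digit_product N u i * digit_product N v (n - i)%N *+ 'C(n, i).
Proof.
move=> q_char.
elim: N u v n => [|N IHN] u v n; first last.
  rewrite (divn_eq n q); set m := (n %/ q)%N; set r := (n %% q)%N => lt_n.
  have lt_rq : (r < q)%N by rewrite ltn_mod ltnW.
  have lt_m : (m < q ^ N)%N.
    rewrite -(ltn_pmul2r (ltnW q_gt1)) -expnSr.
    exact: leq_ltn_trans (leq_addr _ _) lt_n.
  rewrite digit_product_cons // [X in _ * X](IHN (u \o succn) (v \o succn)) //.
  (* Extended to (m + 1)q, the range of i = kq + s becomes the rectangle k <= m, s < q, and the sum
     becomes a double sum. *)
  have lt_nm : (m * q + r < m.+1 * q)%N by rewrite mulSn addnC ltn_add2r.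
  pose F i := digit_product N.+1 u i * digit_product N.+1 v (m * q + r - i).
  rewrite [RHS](sum_bin_widen _ _ _ F lt_nm).
  rewrite -[RHS](big_mkord xpredT (fun i => F i *+ 'C(_, i))).
  rewrite big_nat_mul big_mkord mulr_sumr; apply: eq_bigr => k _.
  have le_km : (k <= m)%N by rewrite -ltnS.
  rewrite -{1}[(k * q)%N]add0n mulSn big_addn addnK big_mkord.
  rewrite addrC exprDn.
  rewrite (sum_bin_widen _ _ _ (fun s => v 0%N ^+ (r - s) * u 0%N ^+ s) lt_rq).
  rewrite mulr_suml; apply: eq_bigr => s _.
  rewrite (addnC s) -[RHS]mulr_natr natr_bin_digit //.
  (* For s > r both sides vanish with C(r, s). Otherwise subtracting kq + s from mq + r needs no
     borrow, so the digits subtract separately. *)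
  have [le_sr|lt_rs] := leqP s r; last first.
    by rewrite !(bin_small lt_rs) muln0 mulr0n mulr0 mul0r.
  have -> : F (k * q + s)%N = (u 0%N ^+ s * digit_product N (u \o succn) k)
     * (v 0%N ^+ (r - s) * digit_product N (v \o succn) (m - k)%N).
    rewrite /F digit_product_cons //.
    rewrite (_ : (m * q + r - _ = (m - k) * q + (r - s))%N).
      by rewrite digit_product_cons // (leq_ltn_trans (leq_subr _ _)).
    by rewrite mulnBl addnBA // addnBAC ?subnDA // leq_mul.
  rewrite natrM -[X in X * _ = _]mulr_natr -[X in _ * X = _]mulr_natr; ring.
rewrite expn0 ltnS leqn0 => /eqP->.
by rewrite big_ord1 /digit_product !big_ord0 mulr1.
Qed.

End DigitProduct.

(** In two variables too, raising to the power q^n is an iterate of Frobenius, hence additive. *)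
Lemma Fq_linear_poly_XaY (F : fieldType) (q : nat) (f : {poly F}) :
  [pchar F].-nat q -> Fq_linear q f -> poly_XaY f = f^:P + f%:P.
Proof.
move=> q_char [N [a ->]]; rewrite /poly_XaY.
rewrite !rmorph_sum /= -big_split; apply: eq_bigr => n _ /=.
rewrite !map_polyZ /= map_polyXn comp_polyZ rmorphXn /= comp_polyX.
rewrite exprDn_pchar; last first.
  by rewrite pnatX !(eq_pnat _ (@pchar_poly _)) q_char.
by rewrite scalerDr -[a n *: _]mul_polyC polyCM mul_polyC rmorphXn.
Qed.

Theorem proposition5 (p lambda : nat) (p_prime : prime p)
    (lambda_gt0 : (0 < lambda)%N) (Fq : finFieldType)
    (card_Fq : #|Fq| = (p ^ lambda)%N) (F : fieldType)
    (iota : {rmorphism Fq -> F}) (e : nat -> {poly F})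
    (e_linear : forall j : nat, Fq_linear (p ^ lambda) (e j)) :
  let P := qadic_product (p ^ lambda) e in
  [/\ nontrivial P, binomial_theorem P & BDstar (generating_function P)].
Proof.
set q := (p ^ lambda)%N => P.
have q_gt1 : (1 < q)%N by rewrite -(exp1n lambda) ltn_exp2r ?prime_gt1.
(* The embedding [iota] carries the characteristic p of [Fq] over to [F]. *)
have q_char : [pchar F].-nat q.
  rewrite pnatX pnatE // (rmorph_pchar iota) //.
  exact: card_finPcharP card_Fq p_prime.
have P_nontrivial : nontrivial P.
  by exists 0%N; rewrite /P /qadic_product big_ord0 oner_eq0.
have P_binomial : binomial_theorem P.
  have q_charPP : [pchar {poly {poly F}}].-nat q.
    by rewrite !(eq_pnat _ (@pchar_poly _)).
  (* In the identity of index [n] all indices are at most [n], so [n] serves as common length. *)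
  have PE n i : (i <= n)%N -> P i = digit_product _ q n e i.
    by move=> le_in; rewrite (digit_product_widen _ _ q_gt1).
  have digit_product_rmorph (S : comNzRingType) (f : {rmorphism {poly F} -> S})
    n i : f (digit_product _ q n e i) = digit_product _ q n (f \o e) i.
    by rewrite rmorph_prod; apply: eq_bigr => t _; rewrite rmorphXn.
  move=> n; rewrite (PE n n) // /poly_XaY !rmorph_prod /=.
  transitivity (digit_product _ q n (fun t => (e t)^:P + (e t)%:P) n).
    apply: eq_bigr => t _; rewrite !rmorphXn /=; congr (_ ^+ _).
    exact: Fq_linear_poly_XaY q_char (e_linear t).
  rewrite (digit_productD _ _ q_gt1 n _ _ n q_charPP (ltn_expl n q_gt1)).
  apply: eq_bigr => i _.
  rewrite (PE n i (leq_ord i)) (PE n (n - i)%N (leq_subr i n)).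
  by rewrite !digit_product_rmorph.
by split=> //; exists P.
Qed.
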